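(* Assume the following: for every oriented one-cusped hyperbolic 3-manifold, every ideal triangulation of it (with any choice of quad types and lifts), every epimorphism $\alpha$ from its fundamental group to $\mathbb Z$ and peripheral curve $\mu$ with $\alpha(\mu)=1$, the determinants $\det(\mathbf A(t))$ and $\det(\mathbf B(t))$ of the twisted Neumann--Zagier matrices are palindromic, i.e. each such Laurent polynomial $p(t)$ satisfies $p(t)=\varepsilon t^r p(1/t)$ for some $\varepsilon=\pm1$ and some integer $r$. Then for every oriented one-cusped hyperbolic 3-manifold $M$ with trace field $F$, every ideal triangulation $\mathcal T$ of $M$ supporting the geometric representation, and every such $\alpha,\mu$, the twisted 1-loop invariant satisfies $$\tau^{\mathrm{CS}}(\mathcal T,t)=\tau^{\mathrm{CS}}(\mathcal T,1/t)\in F[t^{\pm1}]/(\pm t^{\mathbb Z}).$$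
   Context: $M$ is an oriented (complete, finite volume) hyperbolic 3-manifold with one torus cusp. An ideal triangulation $\mathcal T$ of $M$ with $N$ tetrahedra $\Delta_1,\dots,\Delta_N$ has exactly $N$ edges $e_1,\dots,e_N$. A quad type of a tetrahedron is a pair of opposite edges. Fixing a quad type of each oriented tetrahedron $\Delta_j$, the pairs of opposite edges of $\Delta_j$ are labelled by shape parameters $z_j,\ z_j'=\frac1{1-z_j},\ z_j''=1-\frac1{z_j}$ with $z_j\in\mathbb C\setminus\{0,1\}$ (the chosen quad type gets $z_j$; seen from each ideal vertex the labels occur in the counterclockwise cyclic order $z_j,z'_j,z''_j$). The symbol $\square$ stands for no prime, one prime or two primes. $\mathbf G^\square$ is the $N\times N$ matrix whose $(i,j)$-entry is the number of edges of $\Delta_j$ labelled $z_j^\square$ incident (identified) to $e_i$. A peripheral curve is an oriented homotopically non-trivial simple closed curve in the peripheral torus. For a peripheral curve $\gamma$, in normal position with respect to the triangulation of the peripheral torus induced by $\mathcal T$, $\mathbf C_\gamma^\square\in\mathbb Z^N$ is the row vector whose $j$-th entry is the signed number of triangle corners labelled $z_j^\square$ cut off by $\gamma$ (sign $+$ or $-$ according to whether the corner lies to the left or right of $\gamma$). $\mathcal T$ supports the geometric representation if there are shapes $z_j$ satisfying the gluing equations $\prod_j\prod_\square (z_j^{\square})^{\mathbf G^\square_{ij}}=1$ for all $i$ (logarithmically, $\sum_j\sum_\square \mathbf G^\square_{ij}\log z_j^\square=2\pi\sqrt{-1}$) and the completeness equations ($\sum_j\sum_\square \mathbf C^\square_{\gamma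 j}\log z^\square_j=0$), whose holonomy is the geometric (discrete faithful) representation of $\pi_1(M)$; these shapes are used below. Put $\zeta_j=\frac1{z_j}$, $\zeta_j'=\frac1{1-z_j}$, $\zeta_j''=\frac1{z_j(z_j-1)}$, and $\mathrm{diag}(\zeta^\square)=\mathrm{diag}(\zeta_1^\square,\dots,\zeta_N^\square)$. A combinatorial flattening of $\mathcal T$ is a triple $(f,f',f'')$ of column vectors in $\mathbb Z^N$ with $\mathbf Gf+\mathbf G'f'+\mathbf G''f''=(2,\dots,2)^T$, $f+f'+f''=(1,\dots,1)^T$, and $\mathbf C_\gamma f+\mathbf C'_\gamma f'+\mathbf C''_\gamma f''=0$ for every peripheral curve $\gamma$; these always exist. $\widetilde M$ is the cover of $M$ corresponding to $\alpha^{-1}(0)$, with lifted ideal triangulation $\widetilde{\mathcal T}$; its deck group $\mathbb Z$ is generated by the action of $\mu$. Choose lifts $\widetilde e_i,\widetilde\Delta_j$ to $\widetilde{\mathcal T}$. $\mathbf G_k^\square$ is the $N\times N$ matrix whose $(i,j)$-entry is the number of edges of $\mu^k\cdot\widetilde\Delta_j$ labelled $z_j^\square$ incident to $\widetilde e_i$; $\mathbf G^\square(t)=\sum_{k\in\mathbb Z}\mathbf G_k^\square t^k$; the twisted Neumann--Zagier matrices are $\mathbf A(t)=\mathbf G(t)-\mathbf G'(t)$, $\mathbf B(t)=\mathbf G''(t)-\mathbf G'(t)$. The twisted 1-loop invariant is $$\tau^{\mathrm{CS}}(\mathcal T,t)=\frac{\det\big(\mathbf A(t)\,\mathrm{diag}(\zeta)+\mathbf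 B(t)\,\mathrm{diag}(\zeta'')\big)}{\prod_{j=1}^N\zeta_j^{f_j}\zeta_j'^{f_j'}\zeta_j''^{f_j''}}\in F[t^{\pm1}]/(\pm t^{\mathbb Z}),$$ where $/(\pm t^{\mathbb Z})$ means up to multiplication by $\pm t^r$, $r\in\mathbb Z$; modulo this it is independent of the choices of flattening, quad types and lifts. It is known that for any ideal triangulation the quad types can be chosen so that $\mathbf B=\mathbf B(1)$ is invertible. *)

(* Defs.v *)
From HB Require Import structures.
From Stdlib Require Import Relation_Operators.
From mathcomp Require Import all_boot all_order all_fingroup all_algebra.
From mathcomp Require Import complex.
From mathcomp Require Import all_classical all_reals all_analysis.
Import Order.TTheory GRing.Theory Num.Theory.
Import numFieldNormedType.Exports.

Set Implicit Arguments.
Unset Strict Implicit.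
Unset Printing Implicit Defensive.

Local Open Scope classical_set_scope.
Local Open Scope complex_scope.
Local Open Scope ring_scope.

(* [T] is the type of tetrahedra; it is infinite for the triangulation of a
   covering space.  The vertices of a tetrahedron are numbered by ['I_4], and
   its face [v] is the one opposite to the vertex [v].  The face [v] of [x] is
   glued to a face of [adj x v]; [glu x v] maps the three vertices of the face
   to the vertices they are glued to, and [v] to the vertex opposite to the
   image face.
   Orientation: the vertices 1, 2, 3 are in counterclockwise order when seen
   from the vertex 0.  Hence an oriented gluing has odd permutations. *)
Record gluing (T : Type) := Gluing {
  adj : T -> 'I_4 -> T;
  glu : T -> 'I_4 -> 'S_4 }.

(* The last condition excludes a face glued to itself by a reflection. *)
Definition oriented_gluing (T : Type) (X : gluing T) : Prop :=
  forall x v,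
    [/\ adj X (adj X x v) (glu X x v v) = x,
        glu X (adj X x v) (glu X x v v) = ((glu X x v)^-1)%g,
        odd_perm (glu X x v)
      & (adj X x v, glu X x v v) <> (x, v)].

(* An edge of a tetrahedron is the set of its two end vertices. *)
Definition edge (T : Type) : Type := (T * {set 'I_4})%type.

Definition edge_step (T : Type) (X : gluing T) (e e' : edge T) : Prop :=
  exists2 v, v \notin e.2 & e' = (adj X e.1 v, glu X e.1 v @: e.2).

Definition edge_eq (T : Type) (X : gluing T) : edge T -> edge T -> Prop :=
  clos_refl_sym_trans _ (edge_step X).

Definition vertex_step (T : Type) (X : gluing T) (p p' : T * 'I_4) : Prop :=
  exists2 v, v != p.2 & p' = (adj X p.1 v, glu X p.1 v p.2).

Definition vertex_eq (T : Type) (X : gluing T) : T * 'I_4 -> T * 'I_4 -> Prop :=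
  clos_refl_sym_trans _ (vertex_step X).

(* [e] lists representatives of the edges of the triangulation, without
   repetition. *)
Definition edge_numbering (T I : Type) (X : gluing T) (e : I -> edge T) : Prop :=
  (forall i, #|(e i).2| = 2) /\
  (forall a : edge T, #|a.2| = 2 -> exists! i, edge_eq X a (e i)).

(* A single ideal vertex.  Its link is a closed connected oriented surface made
   of 4N triangles; it has 6N sides, and two vertices for each edge of the
   triangulation.  Its Euler characteristic is zero, i.e. it is a torus, when
   there are exactly N edges. *)
Definition one_torus_cusp (N : nat) (X : gluing 'I_N) : Prop :=
  (exists p, forall p', vertex_eq X p p') /\
  (exists e : 'I_N -> edge 'I_N, edge_numbering X e).

(* A path is given by its starting point and by the faces which it crosses
   successively, each named in the tetrahedron which is being left. *)
Definition homotopy_step (S : Type) (next : S -> 'I_4 -> S)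
    (rel : S -> seq 'I_4 -> Prop) (s : S) (p q : seq 'I_4) : Prop :=
  exists p1 r p2, [/\ p = p1 ++ p2, q = p1 ++ r ++ p2
                    & rel (foldl next s p1) r].

Definition homotopic (S : Type) (next : S -> 'I_4 -> S)
    (rel : S -> seq 'I_4 -> Prop) (s : S) : seq 'I_4 -> seq 'I_4 -> Prop :=
  clos_refl_sym_trans _ (homotopy_step next rel s).

(* [(x, (a, b))]: we turn around the edge of [x] common to its faces [a] and
   [b], the next face to be crossed being [a]. *)
Definition turn (T : Type) (X : gluing T) (s : T * ('I_4 * 'I_4)) :
    T * ('I_4 * 'I_4) :=
  let: (x, (a, b)) := s in (adj X x a, (glu X x a b, glu X x a a)).

Definition backtrack (T : Type) (X : gluing T) (x : T) (a : 'I_4) : seq 'I_4 :=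
  [:: a; glu X x a a].

Definition edge_loop (T : Type) (X : gluing T) (x : T) (a b : 'I_4)
    (r : seq 'I_4) : Prop :=
  exists2 n, iter n (turn X) (x, (a, b)) = (x, (a, b)) &
    r = mkseq (fun i => (iter i (turn X) (x, (a, b))).2.1) n.

Definition path_end (T : Type) (X : gluing T) : T -> seq 'I_4 -> T :=
  foldl (adj X).

Fixpoint path_inv (T : Type) (X : gluing T) (x : T) (p : seq 'I_4) : seq 'I_4 :=
  if p is v :: p' then rcons (path_inv X (adj X x v) p') (glu X x v v)
  else [::].

(* The fundamental group of the manifold, at the tetrahedron [x], is the set of
   loops at [x] modulo [homotopic_in_M]. *)
Definition is_loop (T : Type) (X : gluing T) (x : T) (p : seq 'I_4) : Prop :=
  path_end X x p = x.

Definition homotopic_in_M (T : Type) (X : gluing T) :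
    T -> seq 'I_4 -> seq 'I_4 -> Prop :=
  homotopic (adj X) (fun x r =>
    (exists a, r = backtrack X x a) \/
    (exists2 ab, ab.1 != ab.2 & edge_loop X x ab.1 ab.2 r)).

(* The triangles of the vertex link are the pairs (tetrahedron, vertex); the
   corners and the opposite sides of the triangle [(x, v)] are named by the
   [a != v]: the corner lies on the edge [va], the side on the face [a]. *)
Definition link_adj (T : Type) (X : gluing T) (s : T * 'I_4) (a : 'I_4) :
    T * 'I_4 :=
  (adj X s.1 a, glu X s.1 a s.2).

Definition homotopic_in_link (T : Type) (X : gluing T) :
    T * 'I_4 -> seq 'I_4 -> seq 'I_4 -> Prop :=
  homotopic (link_adj X) (fun s r =>
    (exists2 a, a != s.2 & r = backtrack X s.1 a) \/
    (exists2 ab, uniq [:: s.2; ab.1; ab.2] & edge_loop X s.1 ab.1 ab.2 r)).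

Section Hyperbolic.
Variable R : realType.
Local Notation C := R[i].

(* Ideal tetrahedron, in barycentric coordinates. *)
Definition ideal_simplex : set 'rV[R]_4 :=
  [set x | [/\ forall a, 0 <= x 0 a, \sum_a x 0 a = 1 & forall a, x 0 a != 1]].

Definition point_step (T : Type) (X : gluing T) (p p' : T * 'rV[R]_4) : Prop :=
  exists2 v, p.2 0 v = 0 &
    p'.1 = adj X p.1 v /\ forall a, p'.2 0 (glu X p.1 v a) = p.2 0 a.

Definition point_eq (T : Type) (X : gluing T) :
    T * 'rV[R]_4 -> T * 'rV[R]_4 -> Prop :=
  clos_refl_sym_trans _ (point_step X).

(* Upper half-space model: [(x, y, h)] is the point of height [h > 0] above
   [x + iy]. *)
Definition H3 : set (R * R * R) := [set p | 0 < p.2].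

(* Poincare extension of the action of SL(2, C) on the Riemann sphere. *)
Definition act (g : 'M[C]_2) (p : R * R * R) : R * R * R :=
  let z := p.1.1 +i* p.1.2 in
  let a := g 0 0 in let b := g 0 1 in let c := g 1 0 in let d := g 1 1 in
  let h := p.2%:C in
  let den := (c * z + d) * conjc (c * z + d) + c * conjc c * h ^+ 2 in
  let w := ((a * z + b) * conjc (c * z + d) + a * conjc c * h ^+ 2) / den in
  (complex.Re w, complex.Im w, complex.Re (h / den)).

Definition discrete (G : set 'M[C]_2) : Prop :=
  exists2 e : C, 0 < e &
    forall g, G g -> (forall i k, `|(g - 1%:M) i k| < e) -> g = 1%:M.

(* Subgroups of PSL(2, C) are represented by their inverse images in
   SL(2, C). *)
Definition sl2_subgroup (G : set 'M[C]_2) : Prop :=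
  [/\ forall g, G g -> \det g = 1,
      G 1%:M,
      forall g, G g -> G (- g),
      forall g, G g -> G (invmx g)
    & forall g g', G g -> G g' -> G (g *m g')].

Definition acts_freely (G : set 'M[C]_2) : Prop :=
  forall g p, G g -> H3 p -> act g p = p -> g = 1%:M \/ g = - 1%:M.

Definition mu3 := ((@lebesgue_measure R \x @lebesgue_measure R)
                     \x @lebesgue_measure R)%E.

(* The quotient has finite volume: a set of finite volume meets every orbit. *)
Definition finite_covolume (G : set 'M[C]_2) : Prop :=
  exists D : set (R * R * R),
    [/\ measurable D, D `<=` H3,
        forall p, H3 p -> exists2 g, G g & D (act g p)
      & (\int[mu3]_(p in D) ((p.2 ^- 3)%:E) < +oo)%E].

(* [h] maps each point of the glued ideal tetrahedra to a representative in H3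
   of its image in H3 / G; the induced map is a bijection, and the last
   condition says that it identifies the two quotient topologies. *)
Definition homeo_to_quotient (N : nat) (X : gluing 'I_N) (G : set 'M[C]_2)
    (h : 'I_N -> 'rV[R]_4 -> R * R * R) : Prop :=
  [/\ forall j x, ideal_simplex x -> H3 (h j x),
      forall p, H3 p -> exists j x g,
        [/\ ideal_simplex x, G g & act g (h j x) = p],
      forall j x j' x', ideal_simplex x -> ideal_simplex x' ->
        (exists2 g, G g & act g (h j x) = h j' x') <->
        point_eq X (j, x) (j', x')
    & forall V : set (R * R * R), V `<=` H3 ->
        (forall g p, G g -> V p -> V (act g p)) ->
        (open V <->
         forall j, exists2 W : set 'rV[R]_4, open W &
           forall x, ideal_simplex x -> V (h j x) <-> W x)].

Definition hyperbolic (N : nat) (X : gluing 'I_N) : Prop :=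
  exists G h, [/\ sl2_subgroup G, discrete G, acts_freely G, finite_covolume G
                & homeo_to_quotient X G h].

(* Ideal triangulation, with N tetrahedra, of an oriented one-cusped hyperbolic
   3-manifold. *)
Definition ideal_triangulation (N : nat) (X : gluing 'I_N) : Prop :=
  [/\ oriented_gluing X, one_torus_cusp X & hyperbolic X].

(* A closed curve in the vertex link, in normal position and straight in each
   triangle.  If [s := corner i], the [i]-th segment lies in the triangle
   [(tet i, s 0)]; it goes from a point [src i] of the side [s 1] to a point
   [tgt i] of the side [s 2], cutting off the corner [s 3].  Points are given
   by their barycentric coordinates in the triangle. *)
Record link_curve (N : nat) := LinkCurve {
  clen : nat;
  tet : 'I_clen.+1 -> 'I_N;
  corner : 'I_clen.+1 -> 'S_4;
  src : 'I_clen.+1 -> 'rV[R]_4;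
  tgt : 'I_clen.+1 -> 'rV[R]_4 }.
Arguments tet {N} l i.
Arguments corner {N} l i.
Arguments src {N} l i.
Arguments tgt {N} l i.

Definition v0 : 'I_4 := inord 0.
Definition v1 : 'I_4 := inord 1.
Definition v2 : 'I_4 := inord 2.
Definition v3 : 'I_4 := inord 3.

(* [x] is an interior point of the segment between [a] and [b]. *)
Definition on_side (x : 'rV[R]_4) (a b : 'I_4) : Prop :=
  [/\ 0 < x 0 a, 0 < x 0 b, x 0 a + x 0 b = 1
    & forall c, c != a -> c != b -> x 0 c = 0].

Definition normal_closed (N : nat) (X : gluing 'I_N) (g : link_curve N) : Prop :=
  forall i : 'I_(clen g).+1,
    let s := corner g i in let s' := corner g (ordS i) in
    let phi := glu X (tet g i) (s v2) in
    [/\ on_side (src g i) (s v2) (s v3),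
        on_side (tgt g i) (s v1) (s v3),
        tet g (ordS i) = adj X (tet g i) (s v2),
        s' v0 = phi (s v0) /\ s' v1 = phi (s v2)
      & forall c, src g (ordS i) 0 (phi c) = tgt g i 0 c].

Definition simple_curve (N : nat) (g : link_curve N) : Prop :=
  forall i i' : 'I_(clen g).+1, i != i' ->
    tet g i = tet g i' -> corner g i v0 = corner g i' v0 ->
    forall a b : R, 0 <= a <= 1 -> 0 <= b <= 1 ->
      (1 - a) *: src g i + a *: tgt g i <>
      (1 - b) *: src g i' + b *: tgt g i'.

Definition curve_path (N : nat) (g : link_curve N) : seq 'I_4 :=
  [seq corner g i v2 | i <- enum 'I_(clen g).+1].

Definition peripheral_curve (N : nat) (X : gluing 'I_N) (g : link_curve N) :
    Prop :=
  [/\ normal_closed X g, simple_curve g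
    & ~ homotopic_in_link X (tet g ord0, corner g ord0 v0) (curve_path g) [::]].

(* Seen from the vertex [s 0], the corners [s 1], [s 2], [s 3] are in
   counterclockwise order when [s] is even; then the corner cut off by a
   segment going from the side [s 1] to the side [s 2] is on its right. *)
Definition corner_sign (s : 'S_4) : int := if odd_perm s then 1 else -1.

(* The quad type [m] is the pair of opposite edges containing the edge
   {0, m+1}. *)
Definition quad_edges (m : 'I_3) : {set {set 'I_4}} :=
  let e := [set ord0; lift ord0 m]%SET in [set e; ~: e]%SET.

(* Edges labelled by the shape with [s] primes when the chosen quad type is
   [q]; the sum is modulo 3.  By the choice of orientation, the quad types
   0, 1, 2 are in counterclockwise order seen from each vertex. *)
Definition labelled (q s : 'I_3) : {set {set 'I_4}} := quad_edges (q + s).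

(* Number of edges of the tetrahedron [x] labelled by the shape with [s] primes
   and identified to [e]. *)
Definition incidence (T : Type) (X : gluing T) (q s : 'I_3) (x : T)
    (e : edge T) : nat :=
  #|[set E in labelled q s | `[< edge_eq X (x, E) e >]]%SET|.

Definition gluing_mx (N : nat) (X : gluing 'I_N) (q : 'I_N -> 'I_3)
    (e : 'I_N -> edge 'I_N) (s : 'I_3) : 'M[int]_N :=
  \matrix_(i, j) (incidence X (q j) s j (e i))%:Z.

Definition cusp_row (N : nat) (q : 'I_N -> 'I_3) (g : link_curve N)
    (s : 'I_3) : 'rV[int]_N :=
  \row_j \sum_(i | (tet g i == j) &&
           ([set corner g i v0; corner g i v3]%SET \in labelled (q j) s))
      corner_sign (corner g i).

(* Column vectors [f s] for [s] = 0, 1, 2 primes. *)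
Definition flattening (N : nat) (X : gluing 'I_N) (q : 'I_N -> 'I_3)
    (e : 'I_N -> edge 'I_N) (f : 'I_3 -> 'cV[int]_N) : Prop :=
  [/\ \sum_s gluing_mx X q e s *m f s = const_mx 2,
      \sum_s f s = const_mx 1
    & forall g, peripheral_curve X g -> \sum_s cusp_row q g s *m f s = 0].

Definition shape (z : C) (s : 'I_3) : C :=
  nth 0 [:: z; (1 - z)^-1; 1 - z^-1] s.

Definition zeta (z : C) (s : 'I_3) : C :=
  nth 0 [:: z^-1; (1 - z)^-1; (z * (z - 1))^-1] s.

Definition gluing_equations (N : nat) (X : gluing 'I_N) (q : 'I_N -> 'I_3)
    (e : 'I_N -> edge 'I_N) (z : 'I_N -> C) : Prop :=
  forall i, \prod_j \prod_s shape (z j) s ^ gluing_mx X q e s i j = 1.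

Definition completeness_equations (N : nat) (X : gluing 'I_N)
    (q : 'I_N -> 'I_3) (z : 'I_N -> C) : Prop :=
  forall g, peripheral_curve X g ->
    \prod_j \prod_s shape (z j) s ^ cusp_row q g s 0 j = 1.

(* Homogeneous coordinates of infinity, 0, 1, w: the vertices 0, 1, 2, 3 of an
   ideal tetrahedron whose edge {0, 1} has shape w. *)
Definition std_vertex (w : C) (a : 'I_4) : 'cV[C]_2 :=
  \col_i (if i == 0 then nth 0 [:: 1; 0; 1; w] a else nth 0 [:: 0; 1; 1; 1] a).

(* The label of the edge {0, 1} has [- q j] primes, modulo 3. *)
Definition tet_vertex (N : nat) (q : 'I_N -> 'I_3) (z : 'I_N -> C)
    (j : 'I_N) : 'I_4 -> 'cV[C]_2 :=
  std_vertex (shape (z j) (- q j)).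

(* [m j v] is the Moebius transformation placing the neighbour of the
   [j]-th tetrahedron across its face [v]; it is unique up to sign. *)
Definition face_pairing (N : nat) (X : gluing 'I_N) (q : 'I_N -> 'I_3)
    (z : 'I_N -> C) (m : 'I_N -> 'I_4 -> 'M[C]_2) : Prop :=
  forall j v, \det (m j v) = 1 /\
    forall a, a != v -> exists k : C,
      m j v *m tet_vertex q z (adj X j v) (glu X j v a)
        = k *: tet_vertex q z j a.

Fixpoint holonomy (N : nat) (X : gluing 'I_N) (m : 'I_N -> 'I_4 -> 'M[C]_2)
    (j : 'I_N) (p : seq 'I_4) : 'M[C]_2 :=
  if p is v :: p' then m j v *m holonomy X m (adj X j v) p' else 1%:M.

(* The equations are taken in multiplicative form.  By Mostow-Prasad rigidity, a
   discrete faithful representation in PSL(2, C) is the geometric one, up to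
   conjugation and complex conjugation. *)
Definition geometric_shapes (N : nat) (X : gluing 'I_N) (q : 'I_N -> 'I_3)
    (e : 'I_N -> edge 'I_N) (z : 'I_N -> C) : Prop :=
  [/\ forall j, z j != 0 /\ z j != 1,
      gluing_equations X q e z,
      completeness_equations X q z
    & exists2 m, face_pairing X q z m &
        forall j,
          discrete [set g | exists2 p, is_loop X j p &
                      g = holonomy X m j p \/ g = - holonomy X m j p] /\
          forall p, is_loop X j p ->
            holonomy X m j p = 1%:M \/ holonomy X m j p = - 1%:M ->
            homotopic_in_M X j p [::]].

End Hyperbolic.

Arguments tet {R N} l i.
Arguments corner {R N} l i.

(* [alpha] is only meaningful on the loops at the base tetrahedron [b]. *)
Definition epimorphism_to_Z (N : nat) (X : gluing 'I_N) (b : 'I_N)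
    (alpha : seq 'I_4 -> int) : Prop :=
  [/\ forall p p', is_loop X b p -> is_loop X b p' ->
        alpha (p ++ p') = alpha p + alpha p',
      forall p p', is_loop X b p -> is_loop X b p' ->
        homotopic_in_M X b p p' -> alpha p = alpha p'
    & forall n, exists2 p, is_loop X b p & alpha p = n].

(* [alpha] takes the value 1 on the free curve [g], joined to the base. *)
Definition alpha_one (R : realType) (N : nat) (X : gluing 'I_N) (b : 'I_N)
    (alpha : seq 'I_4 -> int) (g : link_curve R N) : Prop :=
  exists2 c, path_end X b c = tet g ord0 &
    alpha (c ++ curve_path g ++ path_inv X b c) = 1.

(* The lifts of the [j]-th tetrahedron are the paths from [b] to [j] modulo
   the kernel of [alpha]; [tl j] is a choice of such a path. *)
Definition tetrahedron_lifts (N : nat) (X : gluing 'I_N) (b : 'I_N)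
    (tl : 'I_N -> seq 'I_4) : Prop :=
  forall j, path_end X b (tl j) = j.

(* [(j, k)] is the translate of the chosen lift of the [j]-th tetrahedron by
   the [k]-th power of mu. *)
Definition cover (N : nat) (X : gluing 'I_N) (b : 'I_N)
    (alpha : seq 'I_4 -> int) (tl : 'I_N -> seq 'I_4) : gluing ('I_N * int) :=
  Gluing
    (fun x v => let j' := adj X x.1 v in
       (j', x.2 + alpha (tl x.1 ++ v :: path_inv X b (tl j'))))
    (fun x v => glu X x.1 v).

Definition edge_proj (N : nat) (a : edge ('I_N * int)) : edge 'I_N :=
  (a.1.1, a.2).

(* [el i] is an edge of the cover, chosen above the [i]-th edge. *)
Definition edge_lifts (N : nat) (X : gluing 'I_N)
    (el : 'I_N -> edge ('I_N * int)) : Prop :=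
  edge_numbering X (fun i => edge_proj (el i)).

Definition twisted_coef (N : nat) (X : gluing 'I_N) (q : 'I_N -> 'I_3)
    (b : 'I_N) (alpha : seq 'I_4 -> int) (tl : 'I_N -> seq 'I_4)
    (el : 'I_N -> edge ('I_N * int)) (s : 'I_3) (k : int) : 'M[int]_N :=
  \matrix_(i, j) (incidence (cover X b alpha tl) (q j) s (j, k) (el i))%:Z.

Section Twisted.
Variable K : fieldType.

(* Laurent polynomial matrices evaluated at a nonzero [u]; the sum over all
   integers [k] has finitely many nonzero terms. *)
Definition twisted_gluing_mx (N : nat) (X : gluing 'I_N) (q : 'I_N -> 'I_3)
    (b : 'I_N) (alpha : seq 'I_4 -> int) (tl : 'I_N -> seq 'I_4)
    (el : 'I_N -> edge ('I_N * int)) (s : 'I_3) (u : K) : 'M[K]_N :=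
  \matrix_(i, j) \sum_(k \in [set: int])
    (twisted_coef X q b alpha tl el s k i j)%:~R * u ^ k.

Definition twistedA (N : nat) (X : gluing 'I_N) (q : 'I_N -> 'I_3)
    (b : 'I_N) (alpha : seq 'I_4 -> int) (tl : 'I_N -> seq 'I_4)
    (el : 'I_N -> edge ('I_N * int)) (u : K) : 'M[K]_N :=
  twisted_gluing_mx X q b alpha tl el 0 u
    - twisted_gluing_mx X q b alpha tl el 1 u.

Definition twistedB (N : nat) (X : gluing 'I_N) (q : 'I_N -> 'I_3)
    (b : 'I_N) (alpha : seq 'I_4 -> int) (tl : 'I_N -> seq 'I_4)
    (el : 'I_N -> edge ('I_N * int)) (u : K) : 'M[K]_N :=
  twisted_gluing_mx X q b alpha tl el 2 u
    - twisted_gluing_mx X q b alpha tl el 1 u.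

End Twisted.

Section OneLoop.
Variable R : realType.

(* Laurent polynomials with complex coefficients are viewed in C(t). *)
Definition ratfun := {fraction {poly R[i]}}.
Definition ct (c : R[i]) : ratfun := tofrac c%:P.
Definition t : ratfun := tofrac 'X.

(* Equality up to multiplication by an element of +-t^Z.  For the trace field
   F, equality in F[t, 1/t] / (+-t^Z) is the restriction of this relation, as
   the units +-t^r belong to F[t, 1/t] for every subfield F of C. *)
Definition eq_up_to_unit (x y : ratfun) : Prop :=
  exists (eps : bool) (r : int), x = (-1) ^+ eps * t ^ r * y.

(* A Laurent polynomial p is given by the map u |-> p(u) on units. *)
Definition palindromic (p : ratfun -> ratfun) : Prop :=
  eq_up_to_unit (p t) (p t^-1).

Definition diag_zeta (N : nat) (z : 'I_N -> R[i]) (s : 'I_3) : 'M[ratfun]_N :=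
  diag_mx (\row_j ct (zeta (z j) s)).

Definition tauCS (N : nat) (X : gluing 'I_N) (q : 'I_N -> 'I_3)
    (b : 'I_N) (alpha : seq 'I_4 -> int) (tl : 'I_N -> seq 'I_4)
    (el : 'I_N -> edge ('I_N * int)) (z : 'I_N -> R[i])
    (f : 'I_3 -> 'cV[int]_N) (u : ratfun) : ratfun :=
  \det (twistedA X q b alpha tl el u *m diag_zeta z 0
        + twistedB X q b alpha tl el u *m diag_zeta z 2)
  / ct (\prod_j \prod_s zeta (z j) s ^ f s j 0).

End OneLoop.

(* Main.v *)
(* The heart of the argument is the symplectic identity
   A(t) B(1/t)^T = B(t) A(1/t)^T.  Its entry at (e, e') is, up to sign, a sum
   over the pairs of distinct edges lying on a common face of a tetrahedron,
   one lifted to e and the other to e', with a sign given by the cyclic order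
   of their quad types.  Crossing the face reverses this sign, since gluings
   are oriented, so the contributions cancel in pairs.
   If some choice of quad types makes det B(t) nonzero, then Q = B(t)^-1 A(t)
   satisfies Q(1/t) = Q(t)^T, so that det (Q D + D') is invariant under
   t -> 1/t for diagonal D and D', and the invariant transforms like det B(t),
   which is palindromic.  If there is none, expanding the determinant along
   the columns writes it as a combination of the det B(t) of the various quad
   types, and the invariant vanishes. *)
Require Import Defs.
From Stdlib Require Import Relation_Operators.
From mathcomp Require Import all_boot all_order all_fingroup all_algebra.
From mathcomp Require Import finmap ring complex.
From mathcomp Require Import all_classical all_reals all_analysis.
Import Order.TTheory GRing.Theory Num.Theory.
Local Open Scope ring_scope.

Set Implicit Arguments.
Unset Strict Implicit.
Unset Printing Implicit Defensive.

(** * Quad types and faces *)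

(** Indicator of the edge of quad type [m] through the vertex 0. The opposite edge is its
    complement, so comparing two values of [in_axis m] treats both edges alike. *)
Definition in_axis (m : 'I_3) (w : 'I_4) : bool :=
  (w == ord0) || (w == lift ord0 m).

(* The edge of quad type [m] lying on the face [v]. *)
Definition face_edge (v : 'I_4) (m : 'I_3) : {set 'I_4} :=
  [set w | in_axis m w != in_axis m v].

(** A transposition fixes the quad type of [{x, y}] and exchanges the other two: it is the
    reflection [m -> c - m] of Z/3 whose [c] is twice the fixed type. *)
Lemma tperm_in_axis (x y : 'I_4) : x != y ->
  exists c : 'I_3, forall m v,
    (in_axis (c - m) (tperm x y v) == in_axis (c - m) (tperm x y ord0))
    = (in_axis m v == in_axis m ord0).
Proof.
case: x => [[|[|[|[|x]]]] xlt] //; case: y => [[|[|[|[|y]]]] ylt] // _;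
  [exists 0|exists 2|exists 1|exists 0|exists 1|exists 2
  |exists 2|exists 1|exists 0|exists 1|exists 2|exists 0];
 move=> [[|[|[|m]]] mlt] // [[|[|[|[|v]]]] vlt] //; by rewrite !permE.
Qed.

(** S_4 acts on the quad types through S_3, the affine group of Z/3, and the linear part of the
    affine map is the signature. The proof composes the reflections given by transpositions. *)
Lemma perm_in_axis (p : 'S_4) :
  exists c : 'I_3, forall m v w,
    (in_axis (c + (-1) ^+ p * m) (p w) != in_axis (c + (-1) ^+ p * m) (p v))
    = (in_axis m w != in_axis m v).
Proof.
suff [c hc] : exists c : 'I_3, forall m v,
    (in_axis (c + (-1) ^+ p * m) (p v) == in_axis (c + (-1) ^+ p * m) (p ord0))
    = (in_axis m v == in_axis m ord0).
  exists c => m v w; move: (hc m v) (hc m w).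
  by do 6?[case: (in_axis _ _)].
have [ts -> {p} ts_ok] := prod_tpermP p.
elim: ts ts_ok => [|t ts IH] /=.
  by move=> _; exists 0 => m v; rewrite big_nil odd_perm1 !perm1 add0r mul1r.
case/andP=> t_ok /IH{IH} [c hc]; rewrite big_cons.
have [c' hc'] := tperm_in_axis t_ok; set p := (\prod_(i <- ts) _)%g in hc *.
exists (c + (-1) ^+ p * c') => m v.
rewrite odd_permM odd_tperm t_ok /=.
have -> : (c + (-1) ^+ p * c' + (-1) ^+ (~~ p) * m = c + (-1) ^+ p * (c' - m))%R.
  by rewrite signrN mulrBr mulNr addrA.
rewrite !permM; move: (hc' m v); move: (hc (c' - m) (tperm t.1 t.2 ord0)).
move: (hc (c' - m) (tperm t.1 t.2 v)).
by do 6?[case: (in_axis _ _)].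
Qed.

(** The minus sign is how orientation enters: odd permutations reverse the cyclic order of the quad
    types. *)
Lemma face_edge_imset (p : 'S_4) : odd_perm p ->
  exists c : 'I_3, forall v m, p @: face_edge v m = face_edge (p v) (c - m).
Proof.
move=> op; have [c hc] := perm_in_axis p; exists c => v m.
apply/setP=> w; rewrite -(permKV p w) mem_imset; last exact: perm_inj.
by rewrite !inE -(hc m); rewrite op expr1 mulN1r.
Qed.

Lemma face_edge_free v m : v \notin face_edge v m.
Proof. by rewrite inE eqxx. Qed.

Lemma quad_edgesE m :
  quad_edges m = [set [set w | in_axis m w]; ~: [set w | in_axis m w]].
Proof. by congr [set _; ~: _]; apply/setP=> w; rewrite !inE. Qed.

Section Prod.
Variable K : comPzRingType.
Variables F F' : {set 'I_4} -> K.

Definition quad_sum (G : {set 'I_4} -> K) (m : 'I_3) : K :=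
  \sum_(E in quad_edges m) G E.

Lemma quad_sumE G m :
  quad_sum G m = G [set w | in_axis m w] + G (~: [set w | in_axis m w]).
Proof.
rewrite /quad_sum quad_edgesE big_setU1 ?big_set1 //=.
rewrite inE; apply/eqP=> /setP/(_ ord0); by rewrite !inE.
Qed.

Lemma face_edgeE v m : face_edge v m =
   if in_axis m v then ~: [set w | in_axis m w] else [set w | in_axis m w].
Proof. by case: ifP => h; apply/setP=> w; rewrite !inE h; case: in_axis. Qed.

(* Two edges of distinct quad types share exactly one vertex, hence lie on
   exactly one common face. *)
Lemma quad_sumM m m' : m != m' ->
  quad_sum F m * quad_sum F' m' = \sum_v F (face_edge v m) * F' (face_edge v m').
Proof.
move=> mm; rewrite !quad_sumE; under eq_bigr do rewrite !face_edgeE.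
rewrite !big_ord_recl big_ord0 /in_axis /= addr0.
case: m m' mm => [[|[|[|m]]] mlt] // [[|[|[|m']]] mlt'] //= _; ring.
Qed.

End Prod.

(** * Determinants *)

(** Multilinearity in the columns: in the Leibniz formula, each product of sums is distributed over
    the choices [f] of one summand per column. *)
Lemma det_sum_col (K : comNzRingType) (n : nat) (I : finType) (F : I -> 'M[K]_n) :
  \det (\matrix_(i, j) \sum_a F a i j) =
  \sum_(f : {ffun 'I_n -> I}) \det (\matrix_(i, j) F (f j) i j).
Proof.
rewrite -det_tr /determinant [RHS](eq_bigr (fun f : {ffun 'I_n -> I} =>
  \sum_(s : 'S_n) (-1) ^+ s * \prod_j F (f j) (s j) j)); last first.
  move=> f _; rewrite -[LHS]det_tr; apply: eq_bigr => s _; congr (_ * _).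
  by apply: eq_bigr => j _; rewrite !mxE.
rewrite exchange_big; apply: eq_bigr => s _; rewrite -big_distrr /=; congr (_ * _).
rewrite -(bigA_distr_bigA (fun j a => F a (s j) j)).
by apply: eq_bigr => j _; rewrite !mxE.
Qed.

Lemma det_scale_col (K : comNzRingType) (n : nat) (c : 'I_n -> K) (A : 'M[K]_n) :
  \det (\matrix_(i, j) (A i j * c j)) = \det A * \prod_j c j.
Proof.
have -> : \matrix_(i, j) (A i j * c j) = A *m diag_mx (\row_j c j).
  by apply/matrixP=> i j; rewrite mul_mx_diag !mxE.
by rewrite det_mulmx det_diag; congr (_ * _); apply: eq_bigr => j _; rewrite mxE.
Qed.

(** Meant for the values at t (index 1) and at 1/t (index 2). With [Q] = B2^-1 A2 the symmetry gives
    A1 = B1 Q^T, so both determinants are those of the B's times one common factor. *)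
Lemma det_lagrangian (K : fieldType) (n : nat)
    (A1 B1 A2 B2 : 'M[K]_n) (c d : 'rV[K]_n) :
  A1 *m B2^T = B1 *m A2^T -> (forall j, c 0 j != 0) ->
  \det B1 != 0 -> \det B2 != 0 ->
  \det (A1 *m diag_mx c + B1 *m diag_mx d) * \det B2 =
  \det (A2 *m diag_mx c + B2 *m diag_mx d) * \det B1.
Proof.
move=> sym c0 dB1 dB2.
have uB1 : B1 \in unitmx by rewrite unitmxE unitfE.
have uB2 : B2 \in unitmx by rewrite unitmxE unitfE.
have [Q e2] : exists Q, A2 = B2 *m Q by exists (invmx B2 *m A2); rewrite mulKVmx.
have e1 : A1 = B1 *m Q^T.
  have uB2T : B2^T \in unitmx by rewrite unitmx_tr.
  by apply: (can_inj (mulmxK uB2T)); rewrite sym -mulmxA -trmx_mul -e2.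
have dc : \det (diag_mx c) != 0.
  by rewrite det_diag prodf_seq_neq0; apply/allP=> j _; rewrite c0.
suff eQ : \det (Q^T *m diag_mx c + diag_mx d)
          = \det (Q *m diag_mx c + diag_mx d).
  rewrite e1 e2 -!mulmxA -!mulmxDr !det_mulmx eQ.
  by rewrite mulrC -[RHS]mulrA (mulrC (\det B1)).
rewrite -det_tr linearD /= trmx_mul trmxK !tr_diag_mx.
(* With D, D' the diagonal matrices of [c], [d]: (D Q + D') D = D (Q D + D'), since D and D'
   commute. *)
apply: (mulIf dc); rewrite -det_mulmx [RHS]mulrC -det_mulmx.
by rewrite mulmxDr mulmxDl mulmxA (diag_mxC d c).
Qed.

(** * Turning around an edge *)

Section Gluing.
Variables (T : Type) (X : gluing T).
Hypothesis oX : oriented_gluing X.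

Lemma adj_glu x v : adj X (adj X x v) (glu X x v v) = x.
Proof. by case: (oX x v). Qed.

Lemma glu_glu x v : glu X (adj X x v) (glu X x v v) = ((glu X x v)^-1)%g.
Proof. by case: (oX x v). Qed.

Lemma edge_step_sym e e' : edge_step X e e' -> edge_step X e' e.
Proof.
case: e => x E [v vE ->]; exists (glu X x v v) => /=.
  by rewrite mem_imset //; exact: perm_inj.
rewrite adj_glu glu_glu -imset_comp; congr pair.
rewrite -[LHS]imset_id; apply: eq_imset => w /=; by rewrite permK.
Qed.

Definition turn_edge (s : T * ('I_4 * 'I_4)) : edge T :=
  (s.1, ~: [set s.2.1; s.2.2])%SET.

Definition turn_swap (s : T * ('I_4 * 'I_4)) : T * ('I_4 * 'I_4) :=
  (s.1, (s.2.2, s.2.1)).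

Lemma turn_edge_swap s : turn_edge (turn_swap s) = turn_edge s.
Proof. by rewrite /turn_edge finset.setUC. Qed.

(** After a turn the second face is the one just entered through; once the direction is reversed,
    the next turn crosses it back. *)
Lemma turn_swapK : cancel (turn X) (turn_swap \o turn X \o turn_swap).
Proof. by case=> x [a b]; rewrite /turn_swap /= adj_glu !glu_glu !permK. Qed.

Lemma turn_inj : injective (turn X).
Proof. exact: can_inj turn_swapK. Qed.

Lemma imset_perm_setC (p : 'S_4) (A : {set 'I_4}) :
  (p @: (~: A) = ~: (p @: A))%SET.
Proof.
apply/setP=> w; rewrite -(permKV p w) finset.in_setC.
by rewrite !mem_imset ?finset.in_setC //; exact: perm_inj.
Qed.

Lemma turn_edge_turn s :
  turn_edge (turn X s) = (adj X s.1 s.2.1, glu X s.1 s.2.1 @: (turn_edge s).2).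
Proof.
case: s => x [a b]; rewrite /turn_edge /=; congr pair.
by rewrite imset_perm_setC imsetU1 imset_set1 finset.setUC.
Qed.

Lemma edge_step_turn s y :
  edge_step X (turn_edge s) y ->
  y = turn_edge (turn X s) \/ y = turn_edge (turn X (turn_swap s)).
Proof.
case=> v; rewrite /= finset.in_setC negbK !inE => /orP[]/eqP-> ->.
  by left; rewrite turn_edge_turn.
by right; rewrite (turn_edge_turn (turn_swap s)) turn_edge_swap.
Qed.

Lemma turn_turn_swap s : turn X (turn_swap (turn X s)) = turn_swap s.
Proof. by have /(congr1 turn_swap) := turn_swapK s; case: (turn X _) => x []. Qed.

(** The two faces containing the edge lead to the next and to the previous position of the turn, so
    the orbit is closed under [edge_step]. *)
Lemma edge_orbit s n : iter n.+1 (turn X) s = s ->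
  forall y, edge_eq X y (turn_edge s) ->
  exists2 i, (i <= n)%N & y = turn_edge (iter i (turn X) s).
Proof.
move=> sn y yE.
pose P y := exists i, y = turn_edge (iter i (turn X) s).
have stepP y1 y2 : edge_step X y1 y2 -> P y1 -> P y2.
  move=> st [i yi]; rewrite {}yi in st.
  case: (edge_step_turn st) => ->; first by exists i.+1.
  (* By periodicity the previous position is the iterate of index [n + i], which makes sense even
     for [i] = 0. *)
  have -> : iter i (turn X) s = turn X (iter (n + i) (turn X) s).
    by rewrite -iterS -addSn addnC iterD sn.
  by rewrite turn_turn_swap turn_edge_swap; eexists.
have [i yi] : P y.
  have : P (turn_edge s) by exists 0%N.
  suff: P (turn_edge s) <-> P y by case.
  elim: yE => {y}[y1 y2 st|//|y1 y2 _ [] //|y1 y2 y3 _ h1 _ h2].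
    by split; apply: stepP => //; exact: edge_step_sym.
  exact: (iff_trans h2 h1).
exists (i %% n.+1)%N; first by rewrite -ltnS ltn_mod.
rewrite yi {1}(divn_eq i n.+1) addnC iterD.
congr (turn_edge (iter _ _ _)).
by elim: (i %/ n.+1)%N => [|k IH]; rewrite ?mul0n // mulSn iterD IH.
Qed.

End Gluing.

(** * Paths and the infinite cyclic cover *)

Section Path.
Variables (T : Type) (X : gluing T).

Lemma path_end_cat x p q : path_end X x (p ++ q) = path_end X (path_end X x p) q.
Proof. exact: foldl_cat. Qed.

Lemma path_end_turn s n :
  path_end X s.1 (mkseq (fun i => (iter i (turn X) s).2.1) n)
  = (iter n (turn X) s).1.
Proof.
elim: n => // n IH; rewrite mkseqS /path_end foldl_rcons -/(path_end _ _ _) IH /=.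
by case: (iter n _ _) => x [].
Qed.

Hypothesis oX : oriented_gluing X.

Lemma path_end_inv x p : path_end X (path_end X x p) (path_inv X x p) = x.
Proof.
elim: p x => //= v p IH x; rewrite /path_end foldl_rcons -/(path_end _ _ _) IH.
exact: adj_glu.
Qed.

Lemma homotopic_insert b p1 r p2 :
  (exists a, r = backtrack X (path_end X b p1) a) \/
    (exists2 ab, ab.1 != ab.2 & edge_loop X (path_end X b p1) ab.1 ab.2 r) ->
  homotopic_in_M X b (p1 ++ p2) (p1 ++ r ++ p2).
Proof. by move=> h; apply: rst_step; exists p1, r, p2. Qed.

(** The inserted detour consists of nested backtracks, one for each face crossed by [q]. *)
Lemma homotopic_path_inv b c p1 q p2 : path_end X b p1 = path_end X c q ->
  homotopic_in_M X b (p1 ++ p2) (p1 ++ path_inv X c q ++ q ++ p2).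
Proof.
elim: q c p1 p2 => [|v q IH] c p1 p2 /= e; first exact: rst_refl.
apply: rst_trans (IH _ p1 p2 e) _; rewrite cat_rcons.
have := @homotopic_insert b (p1 ++ path_inv X (adj X c v) q)
  [:: glu X c v v; v] (q ++ p2).
rewrite -!catA; apply; left; exists (glu X c v v).
rewrite path_end_cat e path_end_inv /backtrack glu_glu //.
by rewrite permK.
Qed.

End Path.

Section Cover.
Variables (N : nat) (X : gluing 'I_N) (b : 'I_N) (alpha : seq 'I_4 -> int).
Variable tl : 'I_N -> seq 'I_4.
Hypothesis oX : oriented_gluing X.
Hypothesis eZ : epimorphism_to_Z X b alpha.
Hypothesis tlP : tetrahedron_lifts X b tl.

Local Notation Y := (Defs.cover X b alpha tl).

(* The change of level along the lift of the path [p] from [j] to the cover. *)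
Definition path_shift (j : 'I_N) (p : seq 'I_4) : int :=
  alpha (tl j ++ p ++ path_inv X b (tl (path_end X j p))).

Lemma lift_loop j p :
  is_loop X b (tl j ++ p ++ path_inv X b (tl (path_end X j p))).
Proof.
rewrite /is_loop !path_end_cat tlP.
by rewrite -{1}(tlP (path_end X j p)) path_end_inv.
Qed.

Lemma alpha_homotopic p p' : is_loop X b p -> is_loop X b p' ->
  homotopic_in_M X b p p' -> alpha p = alpha p'.
Proof. by case: eZ => _ h _; apply: h. Qed.

(** Up to homotopy, a detour to the base along the chosen path [tl] can be inserted between [p] and
    [q]; this splits the loop into two, and [alpha] is additive. *)
Lemma path_shift_cat j p q :
  path_shift j (p ++ q) = path_shift j p + path_shift (path_end X j p) q.
Proof.
case: eZ => aD _ _; rewrite /path_shift -aD; try exact: lift_loop.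
apply: alpha_homotopic; first exact: lift_loop.
  by rewrite /is_loop path_end_cat lift_loop; exact: lift_loop.
rewrite path_end_cat -!catA !(catA (tl j) p).
by apply: homotopic_path_inv; rewrite // path_end_cat !tlP.
Qed.

Lemma path_shift_nil j : path_shift j [::] = 0.
Proof. by have /eqP := path_shift_cat j [::] [::]; rewrite -subr_eq subrr => /eqP. Qed.

Lemma path_shift_backtrack j a : path_shift j (backtrack X j a) = 0.
Proof.
rewrite -(path_shift_nil j); apply: alpha_homotopic; try exact: lift_loop.
apply: rst_sym.
have -> : path_end X j (backtrack X j a) = j by exact: adj_glu.
by apply: homotopic_insert; left; exists a; rewrite tlP.
Qed.

Lemma path_shift_edge_loop j a c r :
  a != c -> edge_loop X j a c r -> path_shift j r = 0.
Proof.
move=> ac er; have rj : path_end X j r = j.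
  by case: er => n en ->; rewrite (path_end_turn _ (j, (a, c))) en.
rewrite -(path_shift_nil j); apply: alpha_homotopic; try exact: lift_loop.
apply: rst_sym; rewrite rj.
by apply: homotopic_insert; right; exists (a, c); rewrite ?tlP.
Qed.

Lemma path_end_cover x p :
  path_end Y x p = (path_end X x.1 p, x.2 + path_shift x.1 p).
Proof.
elim: p x => [|v p IH] [j k] /=; first by rewrite path_shift_nil addr0.
by rewrite IH /= -addrA -(path_shift_cat j [:: v]).
Qed.

Lemma cover_oriented : oriented_gluing Y.
Proof.
move=> [j k] v; case: (oX j v) => h1 h2 h3 h4; split => //; last first.
  by case=> e1 _ e2; apply: h4; rewrite e2 e1.
(* The lift of a backtrack returns to its initial level. *)
have := path_end_cover (j, k) (backtrack X j v).
by rewrite path_shift_backtrack addr0 /= h1.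
Qed.

Lemma iter_turn_cover n j k ac :
  iter n (turn Y) ((j, k), ac) =
  (((iter n (turn X) (j, ac)).1,
    k + path_shift j (mkseq (fun i => (iter i (turn X) (j, ac)).2.1) n)),
   (iter n (turn X) (j, ac)).2).
Proof.
have e2 i : (iter i (turn Y) ((j, k), ac)).2 = (iter i (turn X) (j, ac)).2 /\
    (iter i (turn Y) ((j, k), ac)).1.1 = (iter i (turn X) (j, ac)).1.
  elim: i => //= i [].
  case: (iter i (turn Y) _) => [[x l] [c d]]; case: (iter i (turn X) _) => [y [c' d']] /=.
  by case=> -> -> ->.
rewrite [LHS]surjective_pairing (e2 n).1; congr pair.
rewrite -[LHS]path_end_turn path_end_cover -(path_end_turn X (j, ac)) /=.
by congr (path_end _ _ _, _ + path_shift _ _); apply: eq_map => i; rewrite (e2 i).1.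
Qed.

(* [alpha] vanishes on the loops around the edges, so these lift to loops. *)
Lemma turn_cover_period s : s.2.1 != s.2.2 -> exists n, iter n.+1 (turn Y) s = s.
Proof.
case: s => [[j k] [a c]] /= ac.
pose s := (j, (a, c)).
(* Downstairs the turn is an injection of a finite set, hence periodic. *)
have sn := iter_order (turn_inj oX) s.
case: (fingraph.order _ _) (fingraph.order_gt0 (turn X) s) sn => // n _ sn; exists n.
apply: etrans (iter_turn_cover n.+1 j k (a, c)) _.
rewrite [iter n.+1 (turn X) _]sn (@path_shift_edge_loop j a c) ?addr0 //.
by exists n.+1.
Qed.

(** This makes the sums over all levels [k] finite, so that the twisted entries are Laurent
    polynomials. *)
Lemma edge_levels_finite (e : edge ('I_N * int)) : #|e.2| = 2%N ->
  exists L : seq int, forall y, edge_eq Y y e -> y.1.2 \in L.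
Proof.
case: e => x E /= E2.
have : #|~: E| == 2%N by rewrite cardsCs finset.setCK E2 card_ord.
case/cards2P=> a [c [ac Ec]].
have eE : (x, E) = turn_edge (x, (a, c)).
  by rewrite /turn_edge /= -Ec finset.setCK.
have [n sn] := @turn_cover_period (x, (a, c)) ac.
exists (mkseq (fun i => (iter i (turn Y) (x, (a, c))).1.2) n.+1) => y.
rewrite eE => /(edge_orbit cover_oriented sn)[i ni ->].
by apply/mapP; exists i; rewrite // mem_iota.
Qed.

End Cover.

(** * Symplectic property *)

Section Symplectic.
Variables (N : nat) (X : gluing 'I_N) (b : 'I_N) (alpha : seq 'I_4 -> int).
Variables (tl : 'I_N -> seq 'I_4) (el : 'I_N -> edge ('I_N * int)).
Hypothesis oX : oriented_gluing X.
Hypothesis eZ : epimorphism_to_Z X b alpha.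
Hypothesis tlP : tetrahedron_lifts X b tl.
Hypothesis elP : edge_lifts X el.
Variable K : fieldType.

Local Notation Y := (Defs.cover X b alpha tl).

Definition edge_weight (u : K) (e : edge ('I_N * int)) (x : 'I_N)
    (E : {set 'I_4}) : K :=
  \sum_(k \in [set: int]) `[< edge_eq Y ((x, k), E) e >]%:R * u ^ k.

Lemma incidenceE (q s : 'I_3) y e :
  (incidence Y q s y e)%:Z%:~R =
  \sum_(E in labelled q s) `[< edge_eq Y (y, E) e >]%:R :> K.
Proof.
rewrite -pmulrn /incidence -sum1_card natr_sum.
rewrite big_mkcond [RHS]big_mkcond /=; apply: eq_bigr => E _.
rewrite inE; case: (E \in labelled q s) => //=; by case: asboolP.
Qed.

Lemma twisted_gluing_mxE (q : 'I_N -> 'I_3) (u : K) s i j :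
  twisted_gluing_mx X q b alpha tl el s u i j
  = quad_sum (edge_weight u (el i) j) (q j + s).
Proof.
have [L hL] := edge_levels_finite oX eZ tlP (elP.1 i).
have L0 k E : k \notin [fset k in L]%fset ->
    `[< edge_eq Y ((j, k), E) (el i) >]%:R = 0 :> K.
  rewrite inE /= => kL; case: asboolP => // /hL /= kL'; by rewrite kL' in kL.
rewrite mxE (fsbigTE [fset k in L]%fset); last first.
  move=> k kL; rewrite mxE incidenceE big1 ?mul0r // => E _; exact: L0.
rewrite /quad_sum /edge_weight.
under [RHS]eq_bigr => E _.
  rewrite (fsbigTE [fset k in L]%fset); last by move=> k kL; rewrite L0 // mul0r.
  over.
rewrite exchange_big /=; apply: eq_bigr => k _.
by rewrite mxE incidenceE mulr_suml.
Qed.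

Lemma twistedAE (q : 'I_N -> 'I_3) (u : K) i j :
  twistedA X q b alpha tl el u i j =
  quad_sum (edge_weight u (el i) j) (q j)
    - quad_sum (edge_weight u (el i) j) (q j + 1).
Proof. by rewrite -[q j in RHS]addr0 -addrA add0r -!twisted_gluing_mxE !mxE. Qed.

Lemma twistedBE (q : 'I_N -> 'I_3) (u : K) i j :
  twistedB X q b alpha tl el u i j =
  quad_sum (edge_weight u (el i) j) (q j + 2)
    - quad_sum (edge_weight u (el i) j) (q j + 1).
Proof. by rewrite -!twisted_gluing_mxE !mxE. Qed.

(** Crossing the face [v] raises the level by a fixed [d]; reindexing the sum over levels pulls out
    [u ^ d]. *)
Lemma edge_weight_glue (u : K) e x v (E : {set 'I_4}) : u != 0 -> v \notin E ->
  edge_weight u e (adj X x v) (glu X x v @: E) =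
  u ^ path_shift X b alpha tl x [:: v] * edge_weight u e x E.
Proof.
move=> u0 vE; set d := path_shift _ _ _ _ _ _.
rewrite /edge_weight (@reindex_fsbigT _ _ _ _ _ (fun k => k + d)); last first.
  by exists (fun k => k - d) => k; rewrite ?addrK ?subrK.
rewrite mulr_fsumr; apply: eq_fsbigr => k _.
rewrite expfzDr // mulrA mulrC; congr (_ * _).
have st : edge_step Y (x, k, E) (adj X x v, k + d, glu X x v @: E) by exists v.
congr ((nat_of_bool _)%:R * _); apply/asboolP/asboolP => h.
  by apply: rst_trans h; exact: rst_step.
by apply: rst_trans h; apply: rst_sym; exact: rst_step.
Qed.

(** Passing to the other side [h] of each face multiplies the two weights by inverse powers of [u]
    and exchanges the two products; hence the sum [S] equals [- S]. *)
Lemma face_sum_eq0 (u : K) (e e' : edge ('I_N * int)) : u != 0 -> 2%:R != 0 :> K ->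
  \sum_x \sum_v \sum_m
    (edge_weight u e x (face_edge v m)
       * edge_weight u^-1 e' x (face_edge v (m + 1))
     - edge_weight u e x (face_edge v (m + 1))
       * edge_weight u^-1 e' x (face_edge v m)) = 0.
Proof.
move=> u0 ntwo; rewrite pair_big /=; set S := (X in X = 0).
pose F x v m m' :=
  edge_weight u e x (face_edge v m) * edge_weight u^-1 e' x (face_edge v m').
pose h (p : 'I_N * 'I_4) := (adj X p.1 p.2, glu X p.1 p.2 p.2).
have hK : involutive h.
  by case=> x v; rewrite /h /= adj_glu // glu_glu // permK.
suff SN : S = - S.
  have /eqP : S * 2%:R = 0 by rewrite mulr_natr mulr2n {1}SN addNr.
  by rewrite mulf_eq0 (negbTE ntwo) orbF => /eqP.
rewrite {1}/S (reindex_inj (inv_inj hK)) -sumrN; apply: eq_bigr => -[x v] _ /=.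
have [_ _ op _] := oX x v.
have [c hc] := face_edge_imset op.
have FE m m' : F (adj X x v) (glu X x v v) (c - m) (c - m') = F x v m m'.
  rewrite /F -!hc !edge_weight_glue ?invr_eq0 ?face_edge_free //.
  by rewrite mulrACA -expfzMl divff // exp1rz mul1r.
have inj : injective (fun m : 'I_3 => c - (m + 1)).
  by move=> m m' /addrI /oppr_inj /addIr.
(* This reindexing turns the consecutive pair [(m, m + 1)] into [(c - (m + 1), c - m)], the image of
   the reversed pair. *)
rewrite (reindex_inj inj) -sumrN; apply: eq_bigr => m _.
have -> : c - (m + 1) + 1 = c - m by rewrite opprD addrA subrK.
by rewrite -!/(F _ _ _ _) !FE opprB.
Qed.

Lemma quad_sum_symplectic (u : K) e e' : u != 0 -> 2%:R != 0 :> K ->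
  \sum_x \sum_m
    (quad_sum (edge_weight u e x) m * quad_sum (edge_weight u^-1 e' x) (m + 1)
     - quad_sum (edge_weight u e x) (m + 1)
       * quad_sum (edge_weight u^-1 e' x) m) = 0.
Proof.
move=> u0 ntwo; rewrite -[RHS](@face_sum_eq0 u e e' u0 ntwo).
apply: eq_bigr => x _.
rewrite exchange_big; apply: eq_bigr => m _ /=.
have m1 : m != m + 1 by rewrite -subr_eq0 opprD addNKr.
by rewrite sumrB !quad_sumM // eq_sym.
Qed.

(** For each tetrahedron, the 2 by 2 minor formed from A and B expands to minus the cyclic sum of
    [quad_sum_symplectic], whatever the quad type chosen. *)
Lemma twisted_symplectic (q : 'I_N -> 'I_3) (u : K) : u != 0 -> 2%:R != 0 :> K ->
  twistedA X q b alpha tl el u *m (twistedB X q b alpha tl el u^-1)^T =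
  twistedB X q b alpha tl el u *m (twistedA X q b alpha tl el u^-1)^T.
Proof.
move=> u0 ntwo; apply/matrixP => i i'.
have mulE (P Q : 'M[K]_N) : (P *m Q^T) i i' = \sum_j P i j * Q i' j.
  by rewrite mxE; apply: eq_bigr => j _; rewrite mxE.
rewrite !mulE; apply/eqP; rewrite -subr_eq0 -sumrB; apply/eqP.
apply: oppr_inj; rewrite oppr0 -sumrN.
rewrite -[RHS](@quad_sum_symplectic u (el i) (el i') u0 ntwo).
apply: eq_bigr => j _.
pose G m := quad_sum (edge_weight u (el i) j) m.
pose G' m := quad_sum (edge_weight u^-1 (el i') j) m.
transitivity (- ((G (q j) - G (q j + 1)) * (G' (q j + 2) - G' (q j + 1))
                 - (G (q j + 2) - G (q j + 1)) * (G' (q j) - G' (q j + 1)))).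
  by congr (- (_ * _ - _ * _));
    [exact: twistedAE|exact: twistedBE|exact: twistedBE|exact: twistedAE].
rewrite -!/(G _) -!/(G' _).
rewrite (reindex_inj (addrI (q j))) /= !big_ord_recl big_ord0 addr0.
have -> : q j + lift ord0 ord0 = q j + 1 by congr (_ + _); apply/val_inj.
have -> : q j + lift ord0 (lift ord0 ord0) = q j + 2.
  by congr (_ + _); apply/val_inj.
have -> : q j + 1 + 1 = q j + 2 by rewrite -addrA; congr (_ + _); apply/val_inj.
have -> : q j + 2 + 1 = q j.
  by rewrite -addrA -[RHS]addr0; congr (_ + _); apply/val_inj.
rewrite -!/(G _) -!/(G' _); ring.
Qed.

(* Shifting the quad type by 2 replaces the column of B by that of -A. *)
Definition quad_switch (q : 'I_N -> 'I_3) (f : {ffun 'I_N -> bool})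
    (j : 'I_N) : 'I_3 :=
  if f j then q j + 2 else q j.

(** Adding 2 to the quad type renames G'', G, G' as G, G', G'', so A becomes G'' - G = B - A. *)
Lemma twistedA_switch q f (u : K) i j :
  twistedA X (quad_switch q f) b alpha tl el u i j =
  if f j then twistedB X q b alpha tl el u i j - twistedA X q b alpha tl el u i j
  else twistedA X q b alpha tl el u i j.
Proof.
rewrite [LHS]twistedAE [twistedB _ _ _ _ _ _ _ _ _]twistedBE.
rewrite [twistedA _ q _ _ _ _ _ _ _]twistedAE /quad_switch.
case: (f j) => //.
have -> : q j + 2 + 1 = q j.
  by rewrite -addrA -[RHS]addr0; congr (_ + _); apply/val_inj.
ring.
Qed.

Lemma twistedB_switch q f (u : K) i j :
  twistedB X (quad_switch q f) b alpha tl el u i j =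
  if f j then - twistedA X q b alpha tl el u i j else twistedB X q b alpha tl el u i j.
Proof.
rewrite [LHS]twistedBE [twistedB _ q _ _ _ _ _ _ _]twistedBE.
rewrite [twistedA _ q _ _ _ _ _ _ _]twistedAE /quad_switch.
case: (f j) => //.
have -> : q j + 2 + 1 = q j.
  by rewrite -addrA -[RHS]addr0; congr (_ + _); apply/val_inj.
have -> : q j + 2 + 2 = q j + 1 by rewrite -addrA; congr (_ + _); apply/val_inj.
by rewrite opprB.
Qed.

Definition twisted_mx q (c d : 'rV[K]_N) (u : K) : 'M[K]_N :=
  twistedA X q b alpha tl el u *m diag_mx c
  + twistedB X q b alpha tl el u *m diag_mx d.

Lemma twisted_mxE q c d u i j :
  twisted_mx q c d u i j =
  twistedA X q b alpha tl el u i j * c 0 j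
  + twistedB X q b alpha tl el u i j * d 0 j.
Proof.
rewrite /twisted_mx !mul_mx_diag [LHS]mxE.
by congr (_ + _); rewrite [LHS]mxE.
Qed.

(** In a switched column, A c + B d = (B - A) d + (- A) (- (c + d)). For [c] = zeta and [d] =
    zeta'', the new second weight [- (c + d)] is zeta'. *)
Lemma twisted_mx_switch q f c d u :
  twisted_mx q c d u =
  twisted_mx (quad_switch q f) (\row_j if f j then d 0 j else c 0 j)
    (\row_j if f j then - (c 0 j + d 0 j) else d 0 j) u.
Proof.
apply/matrixP=> i j; rewrite !twisted_mxE twistedA_switch twistedB_switch.
rewrite ![(\row__ _) _ _]mxE; case: (f j) => //; ring.
Qed.

(** Expansion by columns: choosing the A-term in a column amounts to taking, up to sign, the column
    of B for the switched quad type. *)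
Lemma det_twisted_mx q c d u :
  \det (twisted_mx q c d u) =
  \sum_(f : {ffun 'I_N -> bool})
    \det (twistedB X (quad_switch q f) b alpha tl el u) *
    \prod_j (if f j then - c 0 j else d 0 j).
Proof.
pose F (a : bool) := if a then twistedA X q b alpha tl el u *m diag_mx c
                     else twistedB X q b alpha tl el u *m diag_mx d.
have -> : twisted_mx q c d u = \matrix_(i, j) \sum_a F a i j.
  apply/matrixP=> i j; rewrite [RHS]mxE big_bool /=.
  by rewrite /twisted_mx mxE.
rewrite det_sum_col; apply: eq_bigr => f _; rewrite -det_scale_col; congr (\det _).
apply/matrixP=> i j; rewrite [LHS]mxE [RHS]mxE twistedB_switch /F.
by case: (f j); rewrite mul_mx_diag [LHS]mxE ?mulrNN.
Qed.

Lemma det_twisted_mx_eq0 q c d u :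
  (forall f, \det (twistedB X (quad_switch q f) b alpha tl el u) = 0) ->
  \det (twisted_mx q c d u) = 0.
Proof. by move=> B0; rewrite det_twisted_mx big1 // => f _; rewrite B0 mul0r. Qed.

End Symplectic.

(** * Rational functions and symmetry of the invariant *)

Lemma t_neq0 (R : realType) : t R != 0.
Proof. by rewrite tofrac_eq0 polyX_eq0. Qed.

Lemma two_neq0 (R : realType) : 2%:R != 0 :> ratfun R.
Proof.
rewrite -(rmorph_nat (@tofrac {poly R[i]})) tofrac_eq0.
by rewrite -polyC_natr polyC_eq0 pnatr_eq0.
Qed.

Lemma zeta_neq0 (R : realType) (x : R[i]) :
  x != 0 -> x != 1 -> zeta x 0 != 0 /\ zeta x 2 != 0.
Proof.
by move=> x0 x1; split; rewrite /zeta /= invr_eq0 // mulf_neq0 // subr_eq0.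
Qed.

Lemma ct_neq0 (R : realType) (c : R[i]) : c != 0 -> ct c != 0.
Proof. by move=> c0; rewrite tofrac_eq0 polyC_eq0. Qed.

Lemma eq_up_to_unit0 (R : realType) (x : ratfun R) : eq_up_to_unit 0 x -> x = 0.
Proof.
case=> eps [r /esym/eqP].
by rewrite !mulf_eq0 signr_eq0 expfz_eq0 (negbTE (t_neq0 R)) andbF => /eqP.
Qed.

Lemma eq_up_to_unit_both0 (R : realType) (x y : ratfun R) :
  x = 0 -> y = 0 -> eq_up_to_unit x y.
Proof. by move=> -> ->; exists false, 0; rewrite mulr0. Qed.

Lemma mulr_subst_CA (K : comPzRingType) (a x y w : K) :
  w = a * y -> x * w = a * x * y.
Proof. by move=> ->; rewrite mulrCA mulrA. Qed.

Theorem corollary1p8 (R : realType)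
    (det_palindromic :
      forall (N : nat) (X : gluing 'I_N) (q : 'I_N -> 'I_3)
        (b : 'I_N) (alpha : seq 'I_4 -> int) (mu : link_curve R N)
        (tl : 'I_N -> seq 'I_4) (el : 'I_N -> edge ('I_N * int)),
        ideal_triangulation R X ->
        epimorphism_to_Z X b alpha ->
        peripheral_curve X mu ->
        alpha_one X b alpha mu ->
        tetrahedron_lifts X b tl ->
        edge_lifts X el ->
        palindromic (fun u : ratfun R => \det (twistedA X q b alpha tl el u)) /\
        palindromic (fun u : ratfun R => \det (twistedB X q b alpha tl el u)))
    (N : nat) (X : gluing 'I_N) (q : 'I_N -> 'I_3)
    (b : 'I_N) (alpha : seq 'I_4 -> int) (mu : link_curve R N)
    (tl : 'I_N -> seq 'I_4) (el : 'I_N -> edge ('I_N * int))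
    (z : 'I_N -> R[i]) (f : 'I_3 -> 'cV[int]_N) :
  ideal_triangulation R X ->
  epimorphism_to_Z X b alpha ->
  peripheral_curve X mu ->
  alpha_one X b alpha mu ->
  tetrahedron_lifts X b tl ->
  edge_lifts X el ->
  geometric_shapes X q (fun i => edge_proj (el i)) z ->
  flattening R X q (fun i => edge_proj (el i)) f ->
  eq_up_to_unit (tauCS X q b alpha tl el z f (t R))
                (tauCS X q b alpha tl el z f (t R)^-1).
Proof.
move=> tri eZ pc a1 tlP elP [z01 _ _ _] _.
have [oX _ _] := tri.
have pal g := (det_palindromic N X (quad_switch q g) b alpha mu tl el
  tri eZ pc a1 tlP elP).2.
pose c := \row_j ct (zeta (z j) 0); pose d := \row_j ct (zeta (z j) 2).
(* The denominator of [tauCS] is constant in [u], so only numerators need comparing. *)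
suff [eps [r detE]] :
    eq_up_to_unit (\det (twisted_mx X b alpha tl el q c d (t R)))
                  (\det (twisted_mx X b alpha tl el q c d (t R)^-1)).
  by exists eps, r; rewrite [in RHS]mulrA -detE.
have t0 := t_neq0 R.
have [/existsP[g detB]|/existsPn detB0] :=
    boolP [exists g,
      \det (twistedB X (quad_switch q g) b alpha tl el (t R)) != 0].
  have [eps [r detBE]] := pal g; exists eps, r.
  have detB' : \det (twistedB X (quad_switch q g) b alpha tl el (t R)^-1) != 0.
    by apply: contraNneq detB => B0; rewrite detBE B0 mulr0.
  have sym := twisted_symplectic oX eZ tlP elP (quad_switch q g) t0 (two_neq0 R).
  have sw := twisted_mx_switch oX eZ tlP elP q g c d.
  apply: (mulIf detB'); rewrite (sw (t R)) (sw (t R)^-1).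
  apply: etrans (det_lagrangian _ sym _ detB detB') _.
    (* After the switch the first weight is zeta or zeta'', both nonzero as the shape avoids 0 and
       1. *)
    move=> j; rewrite !mxE; have [z0 z1] := z01 j.
    by case: ifP => _; apply: ct_neq0; have [] := zeta_neq0 z0 z1.
  exact: mulr_subst_CA detBE.
(* Every det B vanishes at t in this case; palindromicity carries the vanishing over to 1/t. *)
have detB0' g : \det (twistedB X (quad_switch q g) b alpha tl el (t R)^-1) = 0.
  by apply: eq_up_to_unit0; rewrite -(eqP (negbNE (detB0 g))); exact: pal.
apply: eq_up_to_unit_both0; last exact: det_twisted_mx_eq0 detB0'.
by apply: (det_twisted_mx_eq0 oX eZ tlP elP) => g; exact: eqP (negbNE (detB0 g)).
Qed.
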